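(* Let $A$ be a commutative associative $\mathbb C$-algebra and $\Delta$ a nonzero finite-dimensional $\mathbb C$-vector space of commuting $\mathbb C$-derivations of $A$, with basis $\partial_1,\dots,\partial_n$. Let $\mathcal S_n(A,\Delta)=\{w\in\mathcal W_n(A,\Delta)\mid\mathrm{div}(w)=0\}$, and let $H:\mathcal S_n(A,\Delta)\to\mathfrak{sl}_n\otimes A$ be the crossed homomorphism obtained by restricting $$H\Big(\sum_{i=1}^na_i\partial_i\Big)=\sum_{i=1}^n\sum_{j=1}^nE_{ij}\otimes\partial_i(a_j),\quad a_i\in A.$$ Then there is a functor $\mathcal F_H^A:\mathsf{Rep}_{\mathbb C}(\mathfrak{sl}_n)\to\mathsf{ARep}_{\mathbb C}(\mathcal S_n(A,\Delta))$ defined by $$\mathcal F_H^A(V;\theta)=(V\otimes_{\mathbb C}A;(\alpha\boxplus\theta)\circ\iota_H),\quad\forall(V;\theta)\in\mathsf{Rep}_{\mathbb C}(\mathfrak{sl}_n),$$ and by $\psi\mapsto\psi\otimes\mathrm{Id}_A$ on morphisms.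
   Context: $\mathcal W_n(A,\Delta)$ is the space $A\Delta=A\otimes_{\mathbb C}\Delta$ (free over $A$ with basis $\partial_1,\dots,\partial_n$; write $a\partial$ for $a\otimes\partial$), with Lie bracket $[a\partial,b\delta]=a\partial(b)\delta-b\delta(a)\partial$, and $\alpha:A\Delta\to\mathrm{Der}_{\mathbb C}(A)$ is $\alpha(a\partial)(x)=a\partial(x)$. The divergence $\mathrm{div}:\mathcal W_n(A,\Delta)\to A$ is the $\mathbb C$-linear extension of $\mathrm{div}(a\partial)=\partial(a)$; $\mathcal S_n(A,\Delta)$ is a Lie subalgebra of $\mathcal W_n(A,\Delta)$ and, with the restriction of $\alpha$ (still denoted $\alpha$), forms a Leibniz pair with $A$. A Leibniz pair $(A,\mathcal S,[\cdot,\cdot],\beta)$ is a Lie algebra $\mathcal S$ with a Lie algebra homomorphism $\beta:\mathcal S\to\mathrm{Der}_{\mathbb C}(A)$. An admissible representation $(M;\rho)$ of it is an $A$-module $M$ with a Lie algebra homomorphism $\rho:\mathcal S\to\mathfrak{gl}_{\mathbb C}(M)$ such that $\rho(x)(am)=a\rho(x)m+\beta(x)(a)m$; morphisms in $\mathsf{ARep}_{\mathbb C}(\mathcal S)$ are $A$-module homomorphisms commuting with the actions of $\mathcal S$. $\mathsf{Rep}_{\mathbb C}(\mathfrak{sl}_n)$ is the category of representations of the Lie algebra $\mathfrak{sl}_n$ of traceless complex $n\times n$ matrices; $E_{ij}$ are the matrix units. $\mathfrak{sl}_n\otimes A$ has bracket $[g\otimes a,h\otimes b]=[g,h]\otimes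 ab$; $\mathcal S=\mathcal S_n(A,\Delta)$ acts on it by $\alpha(x)(g\otimes a)=g\otimes\alpha(x)(a)$, and a crossed homomorphism is a linear map $H$ with $H[x,y]=\alpha(x)(Hy)-\alpha(y)(Hx)+[Hx,Hy]$. $\iota_H:\mathcal S\to\mathcal S\ltimes_\alpha(\mathfrak{sl}_n\otimes A)$, $\iota_H(x)=(x,Hx)$, where the target is the semidirect product Lie algebra. $V\otimes_{\mathbb C}A$ has $A$-module structure $a(v\otimes b)=v\otimes ab$, and $(\alpha\boxplus\theta)(x,g\otimes a)(v\otimes b)=v\otimes\alpha(x)(b)+\theta(g)v\otimes ab$. *)

(* Defs.v *)
From HB Require Import structures.
From mathcomp Require Import all_boot all_order all_algebra.
From mathcomp Require Import boolp ring.

Set Implicit Arguments.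
Unset Strict Implicit.
Unset Printing Implicit Defensive.

Import GRing.Theory.
Local Open Scope ring_scope.
Local Open Scope quotient_scope.

Definition bilin (K : fieldType) (U V W : lmodType K) (f : U -> V -> W) :=
  (forall v, linear (f^~ v)) /\ (forall u, linear (f u)).

(* The tensor product of two vector spaces is the quotient of the finite formal
   sums of pairs (u, v) by the congruence [tens_rel]; coefficients are absorbed in
   the left factor.  [tens_ind], [tlift_pure] and [tlift_linear] give its
   universal property. *)

Section Tensor.
Variables (K : fieldType) (U V : lmodType K).
Implicit Types (s t : seq (U * V)).

Inductive tens_rel : seq (U * V) -> seq (U * V) -> Prop :=
| tens_refl s : tens_rel s s
| tens_sym s t : tens_rel s t -> tens_rel t s
| tens_trans s t r : tens_rel s t -> tens_rel t r -> tens_rel s r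
| tens_cat s s' t t' :
    tens_rel s s' -> tens_rel t t' -> tens_rel (s ++ t) (s' ++ t')
| tens_swap s t : tens_rel (s ++ t) (t ++ s)
| tens_addl u u' v : tens_rel [:: (u + u', v)] [:: (u, v); (u', v)]
| tens_addr u v v' : tens_rel [:: (u, v + v')] [:: (u, v); (u, v')]
| tens_scale a u v : tens_rel [:: (a *: u, v)] [:: (u, a *: v)]
| tens_zero v : tens_rel [:: (0, v)] [::].

Definition tens_relb s t : bool := `[< tens_rel s t >].

Lemma tens_relb_equiv : equiv_class_of tens_relb.
Proof.
split=> [s|s t|t s r /asboolP H1 /asboolP H2].
- by apply/asboolP; exact: tens_refl.
- by apply/asboolP/asboolP; apply: tens_sym.
- by apply/asboolP; apply: tens_trans H1 H2.
Qed.

Canonical tens_equiv := EquivRelPack tens_relb_equiv.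

Definition tens := {eq_quot tens_relb}.
HB.instance Definition _ := Choice.on tens.
HB.instance Definition _ := EqQuotient.on tens.

Lemma tens_piP s t : reflect (tens_rel s t) (\pi_tens s == \pi_tens t).
Proof. by rewrite piE; apply: (iffP (asboolP _)). Qed.

Lemma tens_eq s t : tens_rel s t -> \pi_tens s = \pi_tens t.
Proof. by move/tens_piP/eqP. Qed.

Lemma tens_reprP s : tens_rel (repr (\pi_tens s)) s.
Proof. by apply/tens_piP; rewrite reprK. Qed.

Definition seq_scale (a : K) s := [seq (a *: p.1, p.2) | p <- s].

Lemma tens_rel_scale a s t :
  tens_rel s t -> tens_rel (seq_scale a s) (seq_scale a t).
Proof.
elim=> {s t} /=.
- by move=> s; exact: tens_refl.
- by move=> s t _; apply: tens_sym.
- by move=> s t r _ + _; apply: tens_trans.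
- by move=> s s' t t' _ H1 _ H2; rewrite /seq_scale !map_cat; apply: tens_cat.
- by move=> s t; rewrite /seq_scale !map_cat; apply: tens_swap.
- by move=> u u' v; rewrite scalerDr; apply: tens_addl.
- by move=> u v v'; apply: tens_addr.
- move=> b u v; rewrite scalerA mulrC -scalerA; apply: tens_scale.
- by move=> v; rewrite scaler0; apply: tens_zero.
Qed.

Definition tens_add (x y : tens) : tens := \pi_tens (repr x ++ repr y).
Definition tens_scal (a : K) (x : tens) : tens := \pi_tens (seq_scale a (repr x)).

Lemma tens_add_pi s t : tens_add (\pi_tens s) (\pi_tens t) = \pi_tens (s ++ t).
Proof. by apply: tens_eq; apply: tens_cat; apply: tens_reprP. Qed.
Lemma tens_scal_pi a s : tens_scal a (\pi_tens s) = \pi_tens (seq_scale a s).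
Proof. by apply: tens_eq; apply: tens_rel_scale; apply: tens_reprP. Qed.

Lemma tens_pi_ind (P : tens -> Prop) : (forall s, P (\pi_tens s)) -> forall x, P x.
Proof. by move=> H x; rewrite -[x]reprK. Qed.

Lemma tens_addA : associative tens_add.
Proof.
elim/tens_pi_ind=> s; elim/tens_pi_ind=> t; elim/tens_pi_ind=> r.
by rewrite !tens_add_pi catA.
Qed.
Lemma tens_addC : commutative tens_add.
Proof.
elim/tens_pi_ind=> s; elim/tens_pi_ind=> t; rewrite !tens_add_pi.
by apply: tens_eq; apply: tens_swap.
Qed.
Lemma tens_add0 : left_id (\pi_tens [::]) tens_add.
Proof. by elim/tens_pi_ind=> s; rewrite tens_add_pi. Qed.

Lemma seq_scale0 s : tens_rel (seq_scale 0 s) [::].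
Proof.
elim: s => [|[u v] s IH]; first by exact: tens_refl.
rewrite /= scale0r -(cat0s [::]) -cat1s; apply: tens_cat => //; exact: tens_zero.
Qed.

Lemma seq_scaleD a b s :
  tens_rel (seq_scale (a + b) s) (seq_scale a s ++ seq_scale b s).
Proof.
elim: s => [|[u v] s IH] /=; first by exact: tens_refl.
rewrite scalerDl -cat1s.
apply: (tens_trans (tens_cat (tens_addl _ _ _) IH)) => /=.
apply: (@tens_cat [:: (a *: u, v)] [:: (a *: u, v)]); first exact: tens_refl.
rewrite -[_ :: (_ ++ _)]cat1s -[_ :: seq_scale b s]cat1s !catA.
by apply: tens_cat; [exact: tens_swap | exact: tens_refl].
Qed.

Lemma tens_addN : left_inverse (\pi_tens [::]) (tens_scal (-1)) tens_add.
Proof.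
elim/tens_pi_ind=> s; rewrite tens_scal_pi tens_add_pi; apply: tens_eq.
have -> : s = seq_scale 1 s.
  by rewrite /seq_scale -[LHS]map_id; apply: eq_map => -[u v]; rewrite /= scale1r.
set s1 := seq_scale 1 s.
have -> : seq_scale (-1) s1 = seq_scale (-1) s.
  rewrite /s1 /seq_scale -map_comp; apply: eq_map => -[u v] /=.
  by rewrite scale1r.
apply: (tens_trans (tens_sym (seq_scaleD (-1) 1 s))).
by rewrite addNr; apply: seq_scale0.
Qed.

HB.instance Definition _ :=
  GRing.isZmodule.Build tens tens_addA tens_addC tens_add0 tens_addN.

Lemma tens_piD s t : \pi_tens s + \pi_tens t = \pi_tens (s ++ t).
Proof. exact: tens_add_pi. Qed.

Lemma tens_scalA a b x : tens_scal a (tens_scal b x) = tens_scal (a * b) x.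
Proof.
elim/tens_pi_ind: x => s; rewrite !tens_scal_pi /seq_scale -map_comp.
by congr (\pi_tens _); apply: eq_map => -[u v] /=; rewrite scalerA.
Qed.
Lemma tens_scal1 : left_id 1 tens_scal.
Proof.
elim/tens_pi_ind=> s; rewrite tens_scal_pi; congr (\pi_tens _).
by rewrite /seq_scale -[RHS]map_id; apply: eq_map => -[u v]; rewrite /= scale1r.
Qed.
Lemma tens_scalDr : right_distributive tens_scal +%R.
Proof.
move=> a; elim/tens_pi_ind=> s; elim/tens_pi_ind=> t.
by rewrite tens_piD !tens_scal_pi tens_piD /seq_scale map_cat.
Qed.
Lemma tens_scalDl x : {morph tens_scal^~ x : a b / a + b}.
Proof.
elim/tens_pi_ind: x => s a b.
rewrite !tens_scal_pi tens_piD.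
by apply: tens_eq; apply: seq_scaleD.
Qed.

HB.instance Definition _ := GRing.Zmodule_isLmodule.Build K tens
  tens_scalA tens_scal1 tens_scalDr tens_scalDl.

Lemma tens_piZ a s : a *: \pi_tens s = \pi_tens (seq_scale a s).
Proof. exact: tens_scal_pi. Qed.

Definition pure (u : U) (v : V) : tens := \pi_tens [:: (u, v)].

Lemma tens_piE s : \pi_tens s = \sum_(p <- s) pure p.1 p.2.
Proof.
elim: s => [|[u v] s IH]; first by rewrite big_nil.
by rewrite big_cons -IH tens_piD.
Qed.

Lemma tens_spanE (x : tens) : x = \sum_(p <- repr x) pure p.1 p.2.
Proof. by rewrite -tens_piE reprK. Qed.

Lemma tens_ind (P : tens -> Prop) :
  P 0 -> (forall x y, P x -> P y -> P (x + y)) ->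
  (forall u v, P (pure u v)) -> forall x, P x.
Proof. by move=> P0 PD Pp x; rewrite (tens_spanE x); apply: big_ind. Qed.

Lemma pure_bilin : bilin pure.
Proof.
split=> [v a u u'|u a v v'].
- rewrite tens_piZ tens_piD.
  by apply: tens_eq; apply: tens_addl.
- rewrite tens_piZ tens_piD.
  apply: tens_eq; apply: tens_trans (tens_addr _ _ _) _.
  rewrite -[X in tens_rel X _]cat1s; apply: tens_cat; last by exact: tens_refl.
  exact: tens_sym (tens_scale _ _ _).
Qed.

(* The linear map [tens -> W] induced by [f]; only meaningful when [f] is
   bilinear, see [tlift_pure] and [tlift_linear]. *)
Definition tlift (W : lmodType K) (f : U -> V -> W) (x : tens) : W :=
  \sum_(p <- repr x) f p.1 p.2.

Lemma tlift_pi (W : lmodType K) (f : U -> V -> W) s : bilin f ->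
  tlift f (\pi_tens s) = \sum_(p <- s) f p.1 p.2.
Proof.
case=> fl fr; rewrite /tlift.
have fDl v u u' : f (u + u') v = f u v + f u' v.
  by have := fl v 1 u u'; rewrite !scale1r.
have fDr u v v' : f u (v + v') = f u v + f u v'.
  by have := fr u 1 v v'; rewrite !scale1r.
have f0l v : f 0 v = 0.
  by apply: (addrI (f 0 v)); rewrite -fDl !addr0.
have f0r u : f u 0 = 0.
  by apply: (addrI (f u 0)); rewrite -fDr !addr0.
suff H s1 s2 : tens_rel s1 s2 ->
    \sum_(p <- s1) f p.1 p.2 = \sum_(p <- s2) f p.1 p.2 by apply: H (tens_reprP s).
elim=> // {s s1 s2}.
- by move=> s1 s2 s3 _ -> _ ->.
- by move=> s1 s2 s3 s4 _ H1 _ H2; rewrite !big_cat /= H1 H2.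
- by move=> s1 s2; rewrite !big_cat /= addrC.
- by move=> u u' v; rewrite !big_cons !big_nil !addr0 fDl.
- by move=> u v v'; rewrite !big_cons !big_nil !addr0 fDr.
- move=> a u v; rewrite !big_cons !big_nil !addr0 /=.
  have := fl v a u 0; rewrite !addr0 f0l addr0 => ->.
  by have := fr u a v 0; rewrite !addr0 f0r addr0 => ->.
- by move=> v; rewrite big_cons big_nil addr0 f0l.
Qed.

Lemma tlift_pure (W : lmodType K) (f : U -> V -> W) u v : bilin f ->
  tlift f (pure u v) = f u v.
Proof. by move=> fb; rewrite /pure tlift_pi // big_seq1. Qed.

Lemma tlift_linear (W : lmodType K) (f : U -> V -> W) :
  bilin f -> linear (tlift f).
Proof.
move=> fb a x y; elim/tens_pi_ind: x => s; elim/tens_pi_ind: y => t.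
rewrite tens_piZ tens_piD !tlift_pi //.
rewrite big_cat big_map /=; congr (_ + _); rewrite scaler_sumr.
apply: eq_bigr => -[u v] _ /=.
have [fl _] := fb; have := fl v a u 0; rewrite addr0 => ->.
rewrite [f 0 v](_ : _ = 0) ?addr0 //.
by have := fl v (-1) 0 0; rewrite scaler0 addr0 scaleN1r addNr.
Qed.

End Tensor.

Definition tmap (K : fieldType) (U V U' V' : lmodType K)
    (f : U -> U') (g : V -> V') : tens U V -> tens U' V' :=
  tlift (fun u v => pure (f u) (g v)).

(* Closes [t_1 + ... + t_k = 0] when the terms cancel in pairs [x, - x]. *)
Ltac zatom e :=
  lazymatch e with
  | (?a + ?b)%R => first [zatom a | zatom b]
  | (- ?a)%R => zatom a
  | 0%R => fail
  | ?t => tryif is_var t then fail else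
      (let x := fresh "x" in set x := (t in LHS); clearbody x)
  end.
Ltac zcancel :=
  rewrite ?opprD ?opprK ?addrA;
  repeat lazymatch goal with |- ?e = _ => zatom e end;
  rewrite -[LHS]add0r ?addrA;
  repeat match goal with
  | |- context [GRing.opp ?x] =>
      rewrite ?(addrAC _ x) ?(addrAC _ (- x)); rewrite addrK
  end; done.

Section LinearFacts.
Variable K : fieldType.
Implicit Types U V W : lmodType K.

Lemma linP U V (f : U -> V) : linear f ->
  [/\ {morph f : x y / x + y}, forall a, {morph f : x / a *: x},
      f 0 = 0 & {morph f : x / - x}].
Proof.
move=> fl; have f0 : f 0 = 0.
  by have := fl (-1) 0 0; rewrite scaler0 addr0 scaleN1r addNr.
have fZ a x : f (a *: x) = a *: f x by have := fl a x 0; rewrite f0 !addr0.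
split=> // [x y|x]; first by have := fl 1 x y; rewrite !scale1r.
by rewrite -scaleN1r fZ scaleN1r.
Qed.

Lemma lin_sum U V (f : U -> V) I (r : seq I) (F : I -> U) : linear f ->
  f (\sum_(i <- r) F i) = \sum_(i <- r) f (F i).
Proof. by move=> /linP[fD _ f0 _]; apply: (big_morph f fD f0). Qed.

Lemma sum_linear U V I (r : seq I) (F : I -> U -> V) :
  (forall i, linear (F i)) -> linear (fun x => \sum_(i <- r) F i x).
Proof.
move=> Fl a x y; rewrite scaler_sumr -big_split /=.
by apply: eq_bigr => i _; apply: Fl.
Qed.

Lemma sub_linear U V (f g : U -> V) :
  linear f -> linear g -> linear (fun x => f x - g x).
Proof. by move=> fl gl a x y; rewrite fl gl scalerBr opprD addrACA. Qed.

Lemma add_linear U V (f g : U -> V) :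
  linear f -> linear g -> linear (fun x => f x + g x).
Proof. by move=> fl gl a x y; rewrite fl gl scalerDr addrACA. Qed.

Lemma comp_linear U V W (f : V -> W) (g : U -> V) :
  linear f -> linear g -> linear (fun x => f (g x)).
Proof. by move=> fl gl a x y; rewrite gl fl. Qed.

Lemma id_linear U : linear (fun x : U => x).
Proof. by []. Qed.

Lemma bilin_comp U V U' V' W (f : U' -> V' -> W) (g : U -> U') (h : V -> V') :
  linear g -> linear h -> bilin f -> bilin (fun u v => f (g u) (h v)).
Proof.
by move=> gl hl [f1 f2]; split=> [v|u] a x y; rewrite ?gl ?hl ?f1 ?f2.
Qed.

Lemma bilin_sub U V W (f g : U -> V -> W) :
  bilin f -> bilin g -> bilin (fun u v => f u v - g u v).
Proof. by move=> [f1 f2] [g1 g2]; split=> ?; apply: sub_linear. Qed.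

Lemma bilin_sum U V W I (r : seq I) (F : I -> U -> V -> W) :
  (forall i, bilin (F i)) -> bilin (fun u v => \sum_(i <- r) F i u v).
Proof.
move=> Fb; by split=> [v|u]; apply: sum_linear => i; case: (Fb i).
Qed.

Lemma tmap_bilin U V U' V' (f : U -> U') (g : V -> V') : linear f -> linear g ->
  bilin (fun u v => pure (f u) (g v)).
Proof. by move=> fl gl; apply: bilin_comp => //; apply: pure_bilin. Qed.

Lemma tmap_pure U V U' V' (f : U -> U') (g : V -> V') u v :
  linear f -> linear g -> tmap f g (pure u v) = pure (f u) (g v).
Proof. by move=> fl gl; rewrite /tmap tlift_pure //; apply: tmap_bilin. Qed.

Lemma tmap_linear U V U' V' (f : U -> U') (g : V -> V') :
  linear f -> linear g -> linear (tmap f g).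
Proof. by move=> fl gl; apply/tlift_linear/tmap_bilin. Qed.

Lemma tens_lin_eq U V W (f g : tens U V -> W) : linear f -> linear g ->
  (forall u v, f (pure u v) = g (pure u v)) -> f =1 g.
Proof.
move=> /linP[fD _ f0 _] /linP[gD _ g0 _] fg; apply: tens_ind => //.
- by rewrite f0 g0.
- by move=> x y; rewrite fD gD => -> ->.
Qed.

(* Only meaningful when [F] is [quadrilin], see [tlift2_pure]. *)
Definition tlift2 U V U' V' W (F : U -> V -> U' -> V' -> W)
    (x : tens U V) (y : tens U' V') : W :=
  tlift (fun u v => tlift (F u v) y) x.

Definition quadrilin U V U' V' W (F : U -> V -> U' -> V' -> W) :=
  (forall u v, bilin (F u v)) /\ (forall u' v', bilin (fun u v => F u v u' v')).

Lemma tlift2_bilin0 U V U' V' W (F : U -> V -> U' -> V' -> W) y :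
  quadrilin F -> bilin (fun u v => tlift (F u v) y).
Proof. by case=> _ Fb; apply: bilin_sum => p; apply: Fb. Qed.

Lemma tlift2_pure U V U' V' W (F : U -> V -> U' -> V' -> W) u v u' v' :
  quadrilin F -> tlift2 F (pure u v) (pure u' v') = F u v u' v'.
Proof.
move=> Fb; rewrite /tlift2 tlift_pure; last exact: tlift2_bilin0.
by rewrite tlift_pure //; apply: Fb.1.
Qed.

Lemma tlift2_bilin U V U' V' W (F : U -> V -> U' -> V' -> W) :
  quadrilin F -> bilin (tlift2 F).
Proof.
move=> Fb; split=> [y|x]; first by apply: tlift_linear; apply: tlift2_bilin0.
by apply: sum_linear => p; apply: tlift_linear; apply: Fb.1.
Qed.

End LinearFacts.

HB.mixin Record Lmodule_isLie (K : fieldType) L of GRing.Lmodule K L := {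
  lb : L -> L -> L;
  lb_bilin : bilin lb;
  lb_alt : forall x, lb x x = 0;
  lb_jacobi : forall x y z, lb x (lb y z) + lb y (lb z x) + lb z (lb x y) = 0
}.

#[short(type="lieAlgType")]
HB.structure Definition Lie (K : fieldType) :=
  {L of GRing.Lmodule K L & Lmodule_isLie K L}.

Section TensBracket.
Variables (K : fieldType) (U V : lmodType K).
Variable br : tens U V -> tens U V -> tens U V.
Hypothesis brb : bilin br.

Let brDl y : {morph br^~ y : a b / a + b} := let: And4 h _ _ _ := linP (brb.1 y) in h.
Let brDr x : {morph br x : a b / a + b} := let: And4 h _ _ _ := linP (brb.2 x) in h.
Let br0l y : br 0 y = 0 := let: And4 _ _ h _ := linP (brb.1 y) in h.
Let br0r x : br x 0 = 0 := let: And4 _ _ h _ := linP (brb.2 x) in h.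

Lemma tens_bracket_anti :
  (forall u v u' v', br (pure u v) (pure u' v') + br (pure u' v') (pure u v) = 0) ->
  forall x y, br x y + br y x = 0.
Proof.
move=> H; apply: tens_ind => [y|x x' IH IH' y|u v]; first by rewrite br0l br0r addr0.
  by rewrite brDl brDr addrACA IH IH' addr0.
apply: tens_ind => [|y y' IH IH'|u' v']; first by rewrite br0l br0r addr0.
  by rewrite brDl brDr addrACA IH IH' addr0.
exact: H.
Qed.

Lemma tens_bracket_alt :
  (forall u v u' v', br (pure u v) (pure u' v') + br (pure u' v') (pure u v) = 0) ->
  (forall u v, br (pure u v) (pure u v) = 0) -> forall x, br x x = 0.
Proof.
move=> /tens_bracket_anti Ha H; apply: tens_ind => // x y Hx Hy.
by rewrite brDl !brDr Hx Hy add0r addr0 Ha.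
Qed.

Let J x y z := br x (br y z) + br y (br z x) + br z (br x y).

Let J0 y z : J 0 y z = 0.
Proof. by rewrite /J !(br0l, br0r) !addr0. Qed.

Let JD x x' y z : J (x + x') y z = J x y z + J x' y z.
Proof.
by rewrite /J !(brDl, brDr) [RHS]addrACA; congr (_ + _); rewrite [RHS]addrACA.
Qed.

Let Jcyc x y z : J x y z = J y z x.
Proof. by rewrite /J -addrA addrC. Qed.

Lemma tens_bracket_jacobi :
  (forall u v u' v' u'' v'', J (pure u v) (pure u' v') (pure u'' v'') = 0) ->
  forall x y z, br x (br y z) + br y (br z x) + br z (br x y) = 0.
Proof.
move=> H x y z; rewrite -/(J x y z); move: x y z.
apply: tens_ind => [y z|x x' IH IH' y z|u v y z]; first exact: J0.
  by rewrite JD IH IH' addr0.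
rewrite Jcyc; move: y z; apply: tens_ind => [z|x x' IH IH' z|u' v' z].
- exact: J0.
- by rewrite JD IH IH' addr0.
rewrite Jcyc; move: z; apply: tens_ind => [|x x' IH IH'|u'' v''].
- exact: J0.
- by rewrite JD IH IH' addr0.
by rewrite Jcyc.
Qed.

End TensBracket.

Section LieFacts.
Variables (K : fieldType) (L : lieAlgType K).
Implicit Types x y z : L.

Lemma lbDl y : {morph lb^~ y : a b / (a : L) + b}.
Proof. by case: (linP (lb_bilin.1 y)). Qed.
Lemma lbDr x : {morph lb x : a b / a + b}.
Proof. by case: (linP (lb_bilin.2 x)). Qed.
Lemma lbNr x : {morph lb x : a / - a}.
Proof. by case: (linP (lb_bilin.2 x)). Qed.
Lemma lb0l y : lb (0 : L) y = 0.
Proof. by case: (linP (lb_bilin.1 y)). Qed.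
Lemma lb0r x : lb x (0 : L) = 0.
Proof. by case: (linP (lb_bilin.2 x)). Qed.
Lemma lbNl y : {morph lb^~ y : a / - (a : L)}.
Proof. by case: (linP (lb_bilin.1 y)). Qed.
Lemma lb_anti x y : lb x y = - lb y x.
Proof.
apply/eqP; rewrite -addr_eq0; apply/eqP.
by have := lb_alt (x + y); rewrite lbDl !lbDr !lb_alt add0r addr0.
Qed.
End LieFacts.

Section SL.
Variables (K : fieldType) (n : nat).

Definition traceless : {pred 'M[K]_n} := [pred X | \tr X == 0].

Lemma traceless_closed : submod_closed traceless.
Proof.
split=> [|a X Y]; first by rewrite inE mxtrace0.
by rewrite !inE mxtraceD mxtraceZ => /eqP-> /eqP->; rewrite mulr0 addr0.
Qed.
HB.instance Definition _ := GRing.isSubmodClosed.Build K 'M[K]_n traceless traceless_closed.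

Record sl := Sl { sl_val :> 'M[K]_n; sl_valP : sl_val \in traceless }.
HB.instance Definition _ := [isSub for sl_val].
HB.instance Definition _ := [Choice of sl by <:].
HB.instance Definition _ := [SubChoice_isSubLmodule of sl by <:].

Lemma sl_lb_subproof (X Y : sl) : X *m Y - Y *m X \in traceless.
Proof. by rewrite inE raddfB /= mxtrace_mulC subrr. Qed.
Definition sl_lb (X Y : sl) : sl := Sl (sl_lb_subproof X Y).

Lemma sl_lb_bilin : bilin sl_lb.
Proof.
split=> [Y|X] a Z Z'; apply: val_inj => /=.
  rewrite mulmxDl mulmxDr -scalemxAl -scalemxAr scalerBr opprD.
  by rewrite addrACA.
rewrite mulmxDl mulmxDr -scalemxAl -scalemxAr scalerBr opprD.
by rewrite addrACA.
Qed.
Lemma sl_lb_alt X : sl_lb X X = 0.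
Proof. by apply: val_inj; rewrite /= subrr. Qed.
Lemma sl_lb_jacobi X Y Z :
  sl_lb X (sl_lb Y Z) + sl_lb Y (sl_lb Z X) + sl_lb Z (sl_lb X Y) = 0.
Proof.
apply: val_inj => /=; case: X Y Z => [X _] [Y _] [Z _] /=.
rewrite !mulmxBl !mulmxBr !mulmxA.
zcancel.
Qed.
HB.instance Definition _ :=
  Lmodule_isLie.Build K sl sl_lb_bilin sl_lb_alt sl_lb_jacobi.

End SL.

Definition derivation (K : fieldType) (A : comAlgType K) (D : A -> A) :=
  linear D /\ forall a b, D (a * b) = D a * b + a * D b.

Record leibnizPair (K : fieldType) := LeibnizPair {
  lp_alg : comAlgType K;
  lp_lie : lieAlgType K;
  lp_act : lp_lie -> lp_alg -> lp_alg;
  lp_act_der : forall x, derivation (lp_act x);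
  lp_act_lin : forall a, linear (lp_act^~ a);
  lp_act_lb : forall x y a,
    lp_act (lb x y) a = lp_act x (lp_act y a) - lp_act y (lp_act x a)
}.

(* Lie algebra homomorphism [L -> gl(V)], in curried form. *)
Definition is_rep (K : fieldType) (L : lieAlgType K) (V : lmodType K)
    (rho : L -> V -> V) :=
  bilin rho /\
  forall x y v, rho (lb x y) v = rho x (rho y v) - rho y (rho x v).

Record rep (K : fieldType) (L : lieAlgType K) := RepOb {
  rep_mod : lmodType K;
  rep_act : L -> rep_mod -> rep_mod;
  rep_actP : is_rep rep_act
}.

Definition is_rep_hom (K : fieldType) (L : lieAlgType K) (V W : rep L)
    (f : rep_mod V -> rep_mod W) :=
  linear f /\ forall x v, f (rep_act x v) = rep_act x (f v).

(* K acts on an A-module through the structure map [c |-> c%:A] of A. *)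
Section RestrictScalars.
Variables (K : fieldType) (A : comAlgType K) (M : lmodType A).

Definition scalRes : Type := M.
HB.instance Definition _ := GRing.Zmodule.on scalRes.
Definition scalRes_scale (c : K) (m : scalRes) : scalRes := (c%:A : A) *: (m : M).

Lemma scalRes_scaleA a b m :
  scalRes_scale a (scalRes_scale b m) = scalRes_scale (a * b) m.
Proof. by rewrite /scalRes_scale scalerA -scalerAl mul1r scalerA. Qed.
Lemma scalRes_scale1 : left_id 1 scalRes_scale.
Proof. by move=> m; rewrite /scalRes_scale !scale1r. Qed.
Lemma scalRes_scaleDr : right_distributive scalRes_scale +%R.
Proof. by move=> a m m'; rewrite /scalRes_scale scalerDr. Qed.
Lemma scalRes_scaleDl m : {morph scalRes_scale^~ m : a b / a + b}.
Proof. by move=> a b; rewrite /scalRes_scale !scalerDl. Qed.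
HB.instance Definition _ := GRing.Zmodule_isLmodule.Build K scalRes
  scalRes_scaleA scalRes_scale1 scalRes_scaleDr scalRes_scaleDl.
End RestrictScalars.

Definition is_arep (K : fieldType) (P : leibnizPair K) (M : lmodType (lp_alg P))
    (rho : lp_lie P -> M -> M) :=
  @is_rep K (lp_lie P) (scalRes M) rho /\
  forall x a m, rho x (a *: m) = a *: rho x m + lp_act x a *: m.

Record arep (K : fieldType) (P : leibnizPair K) := ARepOb {
  arep_mod : lmodType (lp_alg P);
  arep_act : lp_lie P -> arep_mod -> arep_mod;
  arep_actP : is_arep arep_act
}.

Definition is_arep_hom (K : fieldType) (P : leibnizPair K) (M N : arep P)
    (f : arep_mod M -> arep_mod N) :=
  linear f /\ forall x m, f (arep_act x m) = arep_act x (f m).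

Record category := Category {
  obj : Type;
  mor : obj -> obj -> Type;
  idm : forall X, mor X X;
  cmpm : forall X Y Z, mor Y Z -> mor X Y -> mor X Z;
  cmp1m : forall X Y (f : mor X Y), cmpm (idm Y) f = f;
  cmpm1 : forall X Y (f : mor X Y), cmpm f (idm X) = f;
  cmpmA : forall X Y Z T (h : mor Z T) (g : mor Y Z) (f : mor X Y),
    cmpm h (cmpm g f) = cmpm (cmpm h g) f
}.

Definition is_functor (C D : category) (F : obj C -> obj D)
    (Fm : forall X Y, mor X Y -> mor (F X) (F Y)) :=
  (forall X, Fm X X (idm X) = idm (F X)) /\
  (forall X Y Z (g : mor Y Z) (f : mor X Y),
    Fm X Z (cmpm g f) = cmpm (Fm Y Z g) (Fm X Y f)).

Lemma sval_inj T (P : T -> Prop) (s t : {x | P x}) : sval s = sval t -> s = t.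
Proof. by case: s t => [x p] [y q] /= e; apply: eq_exist. Qed.

Section RepCategory.
Variables (K : fieldType) (L : lieAlgType K).
Definition rep_hom (V W : rep L) := {f | @is_rep_hom K L V W f}.

Lemma rep_hom_id (V : rep L) : @is_rep_hom K L V V id.
Proof. by []. Qed.
Lemma rep_hom_comp (V W X : rep L) (g : rep_hom W X) (f : rep_hom V W) :
  @is_rep_hom K L V X (sval g \o sval f).
Proof.
case: g f => [g [gl gr]] [f [fl fr]]; split=> [a x y|x v] /=.
  by rewrite fl gl.
by rewrite fr gr.
Qed.

Definition rep_hom_idm (V : rep L) : rep_hom V V := exist _ id (rep_hom_id V).
Definition rep_hom_cmp (V W X : rep L) (g : rep_hom W X) (f : rep_hom V W) : rep_hom V X :=
  exist _ (sval g \o sval f) (rep_hom_comp g f).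

Lemma rep_hom_1m V W (f : rep_hom V W) : rep_hom_cmp (rep_hom_idm W) f = f.
Proof. exact: sval_inj. Qed.
Lemma rep_hom_m1 V W (f : rep_hom V W) : rep_hom_cmp f (rep_hom_idm V) = f.
Proof. exact: sval_inj. Qed.
Lemma rep_hom_mA V W X Y (h : rep_hom X Y) (g : rep_hom W X) (f : rep_hom V W) :
  rep_hom_cmp h (rep_hom_cmp g f) = rep_hom_cmp (rep_hom_cmp h g) f.
Proof. exact: sval_inj. Qed.

Definition Rep : category := Category rep_hom_1m rep_hom_m1 rep_hom_mA.
End RepCategory.

Section ARepCategory.
Variables (K : fieldType) (P : leibnizPair K).
Definition arep_hom (M N : arep P) := {f | @is_arep_hom K P M N f}.

Lemma arep_hom_id (M : arep P) : @is_arep_hom K P M M id.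
Proof. by []. Qed.
Lemma arep_hom_comp (M N Q : arep P) (g : arep_hom N Q) (f : arep_hom M N) :
  @is_arep_hom K P M Q (sval g \o sval f).
Proof.
case: g f => [g [gl gr]] [f [fl fr]]; split=> [a x y|x v] /=.
  by rewrite fl gl.
by rewrite fr gr.
Qed.

Definition arep_hom_idm (V : arep P) : arep_hom V V := exist _ id (arep_hom_id V).
Definition arep_hom_cmp (V W X : arep P) (g : arep_hom W X) (f : arep_hom V W) : arep_hom V X :=
  exist _ (sval g \o sval f) (arep_hom_comp g f).

Lemma arep_hom_1m V W (f : arep_hom V W) : arep_hom_cmp (arep_hom_idm W) f = f.
Proof. exact: sval_inj. Qed.
Lemma arep_hom_m1 V W (f : arep_hom V W) : arep_hom_cmp f (arep_hom_idm V) = f.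
Proof. exact: sval_inj. Qed.
Lemma arep_hom_mA V W X Y (h : arep_hom X Y) (g : arep_hom W X) (f : arep_hom V W) :
  arep_hom_cmp h (arep_hom_cmp g f) = arep_hom_cmp (arep_hom_cmp h g) f.
Proof. exact: sval_inj. Qed.

Definition ARep : category := Category arep_hom_1m arep_hom_m1 arep_hom_mA.
End ARepCategory.

Section Current.
Variables (K : fieldType) (g : lieAlgType K) (A : comAlgType K).

Definition current : Type := tens g A.
HB.instance Definition _ := GRing.Lmodule.on current.

Definition cur_lb : current -> current -> current :=
  tlift2 (fun g a h b => pure (lb g h) (a * b)).

Lemma mulr_bilin : bilin (fun a b : A => a * b).
Proof.
split=> [b|a] c x y; first by rewrite mulrDl scalerAl.
by rewrite mulrDr scalerAr.
Qed.

Lemma cur_quadrilin :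
  @quadrilin K g A g A (tens g A) (fun g a h b => pure (lb g h) (a * b)).
Proof.
have [p1 p2] := @pure_bilin K g A.
have [m1 m2] := mulr_bilin; have [l1 l2] := @lb_bilin K g.
split=> [x a|y b]; split=> z.
- exact: comp_linear (p1 _) (l2 x).
- exact: comp_linear (p2 _) (m2 a).
- exact: comp_linear (p1 _) (l1 y).
- exact: comp_linear (p2 _) (m1 b).
Qed.

Lemma cur_lb_pure x a y b : cur_lb (pure x a) (pure y b) = pure (lb x y) (a * b).
Proof. by rewrite /cur_lb tlift2_pure //; apply: cur_quadrilin. Qed.

Lemma cur_lb_bilin : bilin cur_lb.
Proof. by apply: tlift2_bilin; apply: cur_quadrilin. Qed.

Lemma pureDl (U V : lmodType K) (v : V) : {morph (@pure K U V)^~ v : x y / x + y}.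
Proof. by case: (linP ((@pure_bilin K U V).1 v)). Qed.
Lemma pureNl (U V : lmodType K) (v : V) : {morph (@pure K U V)^~ v : x / - x}.
Proof. by case: (linP ((@pure_bilin K U V).1 v)). Qed.
Lemma pure0l (U V : lmodType K) (v : V) : pure (0 : U) v = 0.
Proof. by case: (linP ((@pure_bilin K U V).1 v)). Qed.
Lemma pureDr (U V : lmodType K) (u : U) : {morph (@pure K U V) u : x y / x + y}.
Proof. by case: (linP ((@pure_bilin K U V).2 u)). Qed.
Lemma pureNr (U V : lmodType K) (u : U) : {morph (@pure K U V) u : x / - x}.
Proof. by case: (linP ((@pure_bilin K U V).2 u)). Qed.

Lemma cur_lb_alt x : cur_lb x x = 0.
Proof.
apply: tens_bracket_alt => [|u v u' v'|u v]; first exact: cur_lb_bilin.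
  by rewrite !cur_lb_pure (mulrC v') -pureDl lb_anti addNr pure0l.
by rewrite cur_lb_pure lb_alt pure0l.
Qed.

Lemma cur_lb_jacobi x y z :
  cur_lb x (cur_lb y z) + cur_lb y (cur_lb z x) + cur_lb z (cur_lb x y) = 0.
Proof.
apply: tens_bracket_jacobi => [|u v u' v' u'' v'']; first exact: cur_lb_bilin.
rewrite !cur_lb_pure (mulrC v'' v) (mulrCA v' v) (mulrCA v'' v) (mulrC v'' v').
by rewrite -!pureDl lb_jacobi pure0l.
Qed.

HB.instance Definition _ :=
  Lmodule_isLie.Build K current cur_lb_bilin cur_lb_alt cur_lb_jacobi.
End Current.

Section Crossed.
Variables (K : fieldType) (P : leibnizPair K) (g : lieAlgType K).
Local Notation A := (lp_alg P).
Local Notation S := (lp_lie P).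
Local Notation gA := (current g A).

(* [g (x) a |-> g (x) lp_act x a]. *)
Definition cur_act (x : S) : gA -> gA := tmap id (lp_act x).

Lemma cur_act_pure x u a :
  cur_act x (pure u a) = pure u (lp_act x a).
Proof. by rewrite /cur_act tmap_pure //; apply: (lp_act_der x).1. Qed.

Lemma cur_act_linear x : linear (cur_act x).
Proof. by apply: tmap_linear => //; apply: (lp_act_der x).1. Qed.

Lemma cur_act_bilin : bilin cur_act.
Proof.
split; last exact: cur_act_linear.
move=> t a x y; rewrite /cur_act /tmap /tlift scaler_sumr -big_split /=.
by apply: eq_bigr => p _; rewrite lp_act_lin (pure_bilin _ _).2.
Qed.

Lemma cur_actD x : {morph cur_act x : u v / u + v}.
Proof. by case: (linP (cur_act_linear x)). Qed.
Lemma cur_actN x : {morph cur_act x : u / - u}.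
Proof. by case: (linP (cur_act_linear x)). Qed.
Lemma cur_act0 x : cur_act x 0 = 0.
Proof. by case: (linP (cur_act_linear x)). Qed.

Lemma cur_act_derivation x u v :
  cur_act x (lb u v) = lb (cur_act x u) v + lb u (cur_act x v).
Proof.
move: u v; apply: (@tens_ind K g A) => [v|u u' IH IH' v|h a v].
- by rewrite cur_act0 !lb0l cur_act0 addr0.
- by rewrite cur_actD !lbDl cur_actD IH IH' addrACA.
move: v; apply: (@tens_ind K g A) => [|v v' IH IH'|k b].
- by rewrite cur_act0 !lb0r cur_act0 addr0.
- by rewrite cur_actD !lbDr cur_actD IH IH' addrACA.
have lbE (t t' : gA) : lb t t' = cur_lb t t' by [].
rewrite !lbE cur_lb_pure !cur_act_pure !cur_lb_pure.
by rewrite (lp_act_der x).2 pureDr.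
Qed.

Lemma cur_act_lb x y u :
  cur_act (lb x y) u = cur_act x (cur_act y u) - cur_act y (cur_act x u).
Proof.
move: u; apply: (@tens_lin_eq K g A) => [||h a]; first exact: cur_act_linear.
  by apply: sub_linear; apply: comp_linear; apply: cur_act_linear.
by rewrite !cur_act_pure lp_act_lb pureDr pureNr.
Qed.

Definition crossed_hom (H : S -> gA) :=
  linear H /\
  forall x y, H (lb x y) = cur_act x (H y) - cur_act y (H x) + lb (H x) (H y).

Definition semidirect : Type := (S * gA)%type.
HB.instance Definition _ := GRing.Lmodule.on semidirect.

Definition sd_lb (p q : semidirect) : semidirect :=
  (lb p.1 q.1, cur_act p.1 q.2 - cur_act q.1 p.2 + lb p.2 q.2).

Lemma sd_lb_bilin : bilin sd_lb.
Proof.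
have [l1 l2] := @lb_bilin K gA; have [s1 s2] := @lb_bilin K S.
have [a1 a2] := cur_act_bilin.
split=> [[y v]|[x u]] c [z w] [z' w']; congr pair => /=.
- exact: s1.
- rewrite a1 a2 l1 !scalerDr scalerN opprD.
  by rewrite (addrACA (c *: _)) (addrACA (c *: _ - _)).
- exact: s2.
- rewrite a1 a2 l2 !scalerDr scalerN opprD.
  by rewrite (addrACA (c *: _)) (addrACA (c *: _ - _)).
Qed.

Lemma sd_lb_alt p : sd_lb p p = 0.
Proof. by case: p => x u; rewrite /sd_lb /= !lb_alt subrr addr0. Qed.

Lemma sd_lb_jacobi p q r :
  sd_lb p (sd_lb q r) + sd_lb q (sd_lb r p) + sd_lb r (sd_lb p q) = 0.
Proof.
case: p q r => [x u] [y v] [z w]; congr pair => /=; first exact: lb_jacobi.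
rewrite !(cur_actD, cur_actN, lbDr, lbNr, cur_act_lb, cur_act_derivation).
have := lb_jacobi u v w.
set j1 := lb u (lb v w); set j2 := lb v _; set j3 := lb w (lb u v) => J.
have -> : j3 = - j1 - j2 by rewrite -opprD; apply/eqP; rewrite -addr_eq0 addrC J.
rewrite (lb_anti (cur_act x v)) (lb_anti (cur_act y w)) (lb_anti (cur_act z u)).
zcancel.
Qed.

HB.instance Definition _ :=
  Lmodule_isLie.Build K semidirect sd_lb_bilin sd_lb_alt sd_lb_jacobi.

Definition iota_crossed (H : S -> gA) (x : S) : semidirect := (x, H x).

End Crossed.

Section TensA.
Variables (K : fieldType) (A : comAlgType K) (V : lmodType K).

(* An alias of [tens V A], which is a K-vector space, carrying the A-module
   structure [a (v (x) b) = v (x) ab]; the two are compatible by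
   [scalRes_tensAE]. *)
Definition tensA : Type := tens V A.
HB.instance Definition _ := GRing.Zmodule.on tensA.

Definition tensA_scale (a : A) : tensA -> tensA := tmap id (fun b => a * b).

Lemma tensA_scale_linear a : linear (tensA_scale a : tens V A -> tens V A).
Proof. by apply: tmap_linear => //; apply: (mulr_bilin A).2. Qed.
Lemma tensA_scale_pure a v b :
  tensA_scale a (pure v b : tens V A) = pure v (a * b).
Proof. by rewrite /tensA_scale tmap_pure //; apply: (mulr_bilin A).2. Qed.

Lemma tensA_scaleA a b x :
  tensA_scale a (tensA_scale b x) = tensA_scale (a * b) x.
Proof.
move: x; apply: (@tens_lin_eq K V A) => [||v c].
- by apply: comp_linear; apply: tensA_scale_linear.
- exact: tensA_scale_linear.
by rewrite !tensA_scale_pure mulrA.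
Qed.
Lemma tensA_scale1 : left_id 1 tensA_scale.
Proof.
apply: (@tens_lin_eq K V A) => [||v c] //; first exact: tensA_scale_linear.
by rewrite tensA_scale_pure mul1r.
Qed.
Lemma tensA_scaleDr : right_distributive tensA_scale +%R.
Proof. by move=> a x y; case: (linP (tensA_scale_linear a)) => ->. Qed.
Lemma tensA_scaleDl x : {morph tensA_scale^~ x : a b / a + b}.
Proof.
move=> a b; move: x; apply: (@tens_lin_eq K V A) => [||v c].
- exact: tensA_scale_linear.
- by apply: add_linear; apply: tensA_scale_linear.
by rewrite !tensA_scale_pure mulrDl pureDr.
Qed.

HB.instance Definition _ := GRing.Zmodule_isLmodule.Build A tensA
  tensA_scaleA tensA_scale1 tensA_scaleDr tensA_scaleDl.

Lemma scalRes_tensAE (c : K) (x : tens V A) :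
  (c *: (x : scalRes tensA) : tens V A) = c *: x.
Proof.
have zl : linear (fun x : tens V A => c *: x).
  by move=> a x' y; rewrite scalerDr !scalerA mulrC.
move: x; apply: (@tens_lin_eq K V A) => [||v b] //.
  exact: tensA_scale_linear.
rewrite [LHS]tensA_scale_pure -scalerAl mul1r.
by case: (linP ((@pure_bilin K V A).2 v)) => _ ->.
Qed.
End TensA.

Definition boxplus (K : fieldType) (P : leibnizPair K) (g : lieAlgType K)
    (V : lmodType K) (theta : g -> V -> V)
    (p : semidirect P g) (t : tensA (lp_alg P) V) : tensA (lp_alg P) V :=
  (tmap id (lp_act p.1) t : tens V (lp_alg P))
  + tlift2 (fun h a v b => pure (theta h v) (a * b)) p.2 t.

(* [der_inj] identifies the elements of the abstract vector space with
   derivations, so that this is a subspace of the derivations of [A]. *)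
Record derSpace (K : fieldType) (A : comAlgType K) := DerSpace {
  der_vect :> vectType K;
  der_fun : der_vect -> A -> A;
  der_lin : forall a, linear (der_fun^~ a);
  der_der : forall d, derivation (der_fun d);
  der_comm : forall d d' a, der_fun d (der_fun d' a) = der_fun d' (der_fun d a);
  der_inj : forall d d', der_fun d =1 der_fun d' -> d = d'
}.

Section Witt.
Variables (K : fieldType) (A : comAlgType K) (Delta : derSpace A).
Local Notation "d @ a" := (der_fun d a) (at level 30, right associativity).

Definition witt : Type := tens A Delta.
HB.instance Definition _ := GRing.Lmodule.on witt.

Definition witt_lb : witt -> witt -> witt :=
  tlift2 (fun a d b d' => pure (a * (d @ b)) d' - pure (b * (d' @ a)) d).

Let mull (b : A) : linear (fun a => a * b). Proof. exact: (mulr_bilin A).1. Qed.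
Let mulr (a : A) : linear (fun b => a * b). Proof. exact: (mulr_bilin A).2. Qed.

Lemma witt_quadrilin : @quadrilin K A Delta A Delta (tens A Delta)
  (fun a d b d' => pure (a * (d @ b)) d' - pure (b * (d' @ a)) d).
Proof.
have [p1 p2] := @pure_bilin K A Delta.
have dl d := (@der_der _ _ Delta d).1; have dr := @der_lin _ _ Delta.
split=> [a d|b d']; apply: bilin_sub; split=> [e|c].
- by apply: (comp_linear (p1 e)); apply: (comp_linear (mulr a)); apply: dl.
- exact: p2.
- by apply: (comp_linear (p1 d)); apply: mull.
- by apply: (comp_linear (p1 d)); apply: (comp_linear (mulr c)); apply: dr.
- by apply: (comp_linear (p1 d')); apply: mull.
- by apply: (comp_linear (p1 d')); apply: (comp_linear (mulr c)); apply: dr.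
- by apply: (comp_linear (p1 e)); apply: (comp_linear (mulr b)); apply: dl.
- exact: p2.
Qed.

Lemma witt_lb_pure a d b d' :
  witt_lb (pure a d) (pure b d') =
  pure (a * (d @ b)) d' - pure (b * (d' @ a)) d.
Proof. by rewrite /witt_lb tlift2_pure //; apply: witt_quadrilin. Qed.

Lemma witt_lb_bilin : bilin witt_lb.
Proof. by apply: tlift2_bilin; apply: witt_quadrilin. Qed.

Lemma witt_lb_alt x : witt_lb x x = 0.
Proof.
apply: tens_bracket_alt => [|a d b d'|a d]; first exact: witt_lb_bilin.
  by rewrite !witt_lb_pure addrA subrK subrr.
by rewrite witt_lb_pure subrr.
Qed.

Lemma witt_lb_jacobi x y z :
  witt_lb x (witt_lb y z) + witt_lb y (witt_lb z x) + witt_lb z (witt_lb x y) = 0.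
Proof.
have [w1 w2] := witt_lb_bilin.
apply: tens_bracket_jacobi => [|a d b d' c d'']; first exact: witt_lb_bilin.
have lB t u v : witt_lb t (u - v) = witt_lb t u - witt_lb t v.
  by case: (linP (w2 t)) => lD _ _ lN; rewrite lD lN.
rewrite !witt_lb_pure !lB !witt_lb_pure.
have dM e := (@der_der _ _ Delta e).2; have dC := @der_comm _ _ Delta.
transitivity (pure (a * d @ (b * d' @ c) - b * d' @ (a * d @ c)
                    - (a * d @ b) * d' @ c + (b * d' @ a) * d @ c) d''
            + pure (c * d'' @ (a * d @ b) - a * d @ (c * d'' @ b)
                    - (c * d'' @ a) * d @ b + (a * d @ c) * d'' @ b) d'
            + pure (b * d' @ (c * d'' @ a) - c * d'' @ (b * d' @ a)
                    - (b * d' @ c) * d'' @ a + (c * d'' @ b) * d' @ a) d).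
  apply/eqP; rewrite -subr_eq0; apply/eqP; rewrite !(pureDl, pureNl).
  by zcancel.
rewrite !dM [d' @ d @ c]dC [d @ d'' @ b]dC [d'' @ d' @ a]dC.
rewrite [X in pure X d''](_ : _ = 0) ?[X in pure X d'](_ : _ = 0) ?[X in pure X d](_ : _ = 0).
- by rewrite !pure0l !addr0.
all: by ring.
Qed.

HB.instance Definition _ :=
  Lmodule_isLie.Build K witt witt_lb_bilin witt_lb_alt witt_lb_jacobi.

Definition witt_act (w : witt) (x : A) : A :=
  tlift (fun a (d : Delta) => a * (d @ x)) w.

Lemma witt_act_bilin0 x : bilin (fun a (d : Delta) => a * (d @ x)).
Proof. exact: bilin_comp (@id_linear K A) (@der_lin _ _ Delta x) (mulr_bilin A). Qed.

Lemma witt_act_pure a d x : witt_act (pure a d) x = a * (d @ x).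
Proof. by rewrite /witt_act tlift_pure //; apply: witt_act_bilin0. Qed.

Lemma witt_act_lin x : linear (witt_act^~ x).
Proof. by apply: tlift_linear; apply: witt_act_bilin0. Qed.

Lemma witt_act_der w : derivation (witt_act w).
Proof.
split.
  apply: sum_linear => p; apply: (comp_linear (mulr p.1)).
  exact: (@der_der _ _ Delta p.2).1.
move=> x y; move: w; apply: (@tens_lin_eq K A Delta) => [||a d].
- exact: witt_act_lin.
- apply: add_linear.
    exact: comp_linear (mull y) (witt_act_lin x).
  exact: comp_linear (mulr x) (witt_act_lin y).
by rewrite !witt_act_pure (@der_der _ _ Delta d).2; ring.
Qed.

Lemma witt_act_lb w w' x :
  witt_act (lb w w') x = witt_act w (witt_act w' x) - witt_act w' (witt_act w x).
Proof.
have [w1 w2] := witt_lb_bilin.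
have al t := (witt_act_der t).1.
move: w; apply: (@tens_lin_eq K A Delta) => [||a d].
- exact: comp_linear (witt_act_lin x) (w1 w').
- apply: sub_linear; first exact: witt_act_lin.
  exact: comp_linear (al w') (witt_act_lin x).
move: w'; apply: (@tens_lin_eq K A Delta) => [||b d'].
- exact: comp_linear (witt_act_lin x) (w2 _).
- apply: sub_linear; last exact: witt_act_lin.
  exact: comp_linear (al _) (witt_act_lin x).
have lbE (t t' : witt) : lb t t' = witt_lb t t' by [].
case: (linP (witt_act_lin x)) => aD _ _ aN.
rewrite lbE witt_lb_pure aD aN !witt_act_pure !(@der_der _ _ Delta _).2.
by rewrite (@der_comm _ _ Delta d'); ring.
Qed.

Definition divergence (w : witt) : A := tlift (fun a (d : Delta) => d @ a) w.

Lemma divergence_bilin0 : bilin (fun a (d : Delta) => d @ a).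
Proof.
by split=> [d|a]; [exact: (@der_der _ _ Delta d).1 | exact: (@der_lin _ _ Delta)].
Qed.

Lemma divergence_pure a d : divergence (pure a d) = d @ a.
Proof. by rewrite /divergence tlift_pure //; apply: divergence_bilin0. Qed.

Lemma divergence_linear : linear divergence.
Proof. by apply: tlift_linear; apply: divergence_bilin0. Qed.

Lemma divergence_lb w w' :
  divergence (lb w w') =
  witt_act w (divergence w') - witt_act w' (divergence w).
Proof.
have [w1 w2] := witt_lb_bilin; have dl := divergence_linear.
have al t := (witt_act_der t).1.
move: w; apply: (@tens_lin_eq K A Delta) => [||a d].
- exact: comp_linear dl (w1 w').
- apply: sub_linear; first exact: witt_act_lin.
  exact: comp_linear (al w') dl.
move: w'; apply: (@tens_lin_eq K A Delta) => [||b d'].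
- exact: comp_linear dl (w2 _).
- apply: sub_linear; last exact: witt_act_lin.
  exact: comp_linear (al _) dl.
have lbE (t t' : witt) : lb t t' = witt_lb t t' by [].
case: (linP dl) => aD _ _ aN.
rewrite lbE witt_lb_pure aD aN !witt_act_pure !divergence_pure.
rewrite !(@der_der _ _ Delta _).2 [d' @ d @ b]der_comm [d' @ d @ a]der_comm.
by ring.
Qed.

Definition divfree : {pred witt} := [pred w | divergence w == 0].

Lemma divfree_closed : submod_closed divfree.
Proof.
split=> [|a x y]; first by rewrite inE; case: (linP divergence_linear) => _ _ -> _.
by rewrite !inE divergence_linear => /eqP-> /eqP->; rewrite scaler0 addr0.
Qed.
HB.instance Definition _ := GRing.isSubmodClosed.Build K witt divfree divfree_closed.

Record special := Special { special_val :> witt; specialP : special_val \in divfree }.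
HB.instance Definition _ := [isSub for special_val].
HB.instance Definition _ := [Choice of special by <:].
HB.instance Definition _ := [SubChoice_isSubLmodule of special by <:].

Lemma special_lb_subproof (x y : special) : lb (x : witt) (y : witt) \in divfree.
Proof.
case: x y => [x /eqP x0] [y /eqP y0] /=; rewrite inE divergence_lb x0 y0.
have a0 t : witt_act t 0 = 0 by case: (linP (witt_act_der t).1).
by rewrite !a0 subrr.
Qed.
Definition special_lb (x y : special) : special := Special (special_lb_subproof x y).

Lemma special_lb_bilin : bilin special_lb.
Proof.
have [w1 w2] := @lb_bilin K witt.
by split=> [y|x] a z z'; apply: val_inj => /=; rewrite ?w1 ?w2.
Qed.
Lemma special_lb_alt x : special_lb x x = 0.
Proof. by apply: val_inj; rewrite /= lb_alt. Qed.
Lemma special_lb_jacobi x y z :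
  special_lb x (special_lb y z) + special_lb y (special_lb z x)
  + special_lb z (special_lb x y) = 0.
Proof. by apply: val_inj; rewrite /= lb_jacobi. Qed.
HB.instance Definition _ :=
  Lmodule_isLie.Build K special special_lb_bilin special_lb_alt special_lb_jacobi.

Lemma special_act_lin a : linear (fun x : special => witt_act x a).
Proof. by move=> c x y /=; apply: witt_act_lin. Qed.

Definition special_pair : leibnizPair K :=
  @LeibnizPair K A special (fun x => witt_act (special_val x))
    (fun x => witt_act_der (special_val x)) special_act_lin
    (fun x y => witt_act_lb (special_val x) (special_val y)).

End Witt.

Section DivH.
Variables (K : numFieldType) (A : comAlgType K) (Delta : derSpace A).
Variables (n : nat) (e : n.-tuple Delta).
Local Notation "d @ a" := (der_fun d a) (at level 30, right associativity).
Local Notation dd i := (tnth e i).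

(* For a basis [e] of [Delta] this is the map sending [\sum_i a_i (x) e_i] to
   [\sum_(i, j) E_ij (x) e_i(a_j)], see [gl_mapE]. *)
Definition gl_map (w : witt Delta) : tens 'M[K]_n A :=
  tlift (fun a (d : Delta) =>
    \sum_i \sum_j pure (delta_mx i j) (dd i @ (coord e j d *: a))) w.

Lemma gl_map_bilin0 : bilin (fun a (d : Delta) =>
    \sum_i \sum_j pure (delta_mx i j : 'M[K]_n) (dd i @ (coord e j d *: a))).
Proof.
have [p1 p2] := @pure_bilin K 'M[K]_n A.
apply: bilin_sum => i; apply: bilin_sum => j; split=> [d|a] c x y.
  by rewrite scalerDr scalerA mulrC -scalerA (@der_der _ _ Delta _).1 p2.
by rewrite linearP /= scalerDl -scalerA (@der_der _ _ Delta _).1 p2.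
Qed.

Lemma gl_map_linear : linear gl_map.
Proof. by apply: tlift_linear; apply: gl_map_bilin0. Qed.

Lemma gl_mapE (a : 'I_n -> A) : free e ->
  gl_map (\sum_i (pure (a i) (dd i) : witt Delta)) =
  \sum_i \sum_j pure (delta_mx i j) (dd i @ a j).
Proof.
move=> fe; have p0 (x : 'M[K]_n) : pure x (0 : A) = 0.
  by case: (linP ((@pure_bilin K 'M[K]_n A).2 x)).
rewrite (lin_sum _ _ gl_map_linear).
under eq_bigr => k _ do rewrite /gl_map (tlift_pure _ _ gl_map_bilin0).
rewrite exchange_big; apply: eq_bigr => i _.
rewrite exchange_big; apply: eq_bigr => j _ /=.
have cE k : coord e j (dd k) = (k == j)%:R by rewrite (tnth_nth 0) coord_free.
rewrite (bigD1 j) //= big1 => [|k kj]; first by rewrite cE eqxx scale1r addr0.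
rewrite cE (negPf kj) scale0r.
by case: (linP (@der_der _ _ Delta (dd i)).1) => _ _ -> _.
Qed.

Lemma sl_proj_subproof (X : 'M[K]_n) : X - (\tr X / n%:R)%:M \in @traceless K n.
Proof.
rewrite inE raddfB /= mxtrace_scalar; case: n X => [|m] X.
  by rewrite /mxtrace big_ord0 mul0r subrr.
by rewrite -[_ / _ *+ _]mulr_natr divfK ?subrr // Num.Theory.pnatr_eq0.
Qed.
Definition sl_proj (X : 'M[K]_n) : sl K n := Sl (sl_proj_subproof X).

Lemma sl_proj_linear : linear sl_proj.
Proof.
move=> a X Y; apply: val_inj => /=.
rewrite mxtraceD mxtraceZ mulrDl -mulrA raddfD /= -scale_scalar_mx.
by rewrite scalerBr opprD addrACA.
Qed.

Lemma sl_val_linear : linear (@sl_val K n).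
Proof. by []. Qed.

(* The restriction of [gl_map] to divergence free elements, with values in
   [sl_n (x) A]: [gl_map w] has trace [divergence w], so applying the projection
   [gl_n -> sl_n] does not change it; see [special_mapP]. *)
Definition special_map (w : special Delta) : current (sl K n) A :=
  tmap sl_proj id (gl_map w).

Lemma sl_valK : cancel (tmap (@sl_val K n) id : current (sl K n) A -> tens 'M[K]_n A)
  (tmap sl_proj id).
Proof.
have il := @id_linear K A; have vl := sl_val_linear; have pl := sl_proj_linear.
apply: (@tens_lin_eq K (sl K n) A) => [||X a] //.
  by apply: comp_linear; apply: tmap_linear.
rewrite !tmap_pure //; congr pure; apply: val_inj => /=.
by case: X => X /= /eqP ->; rewrite mul0r raddf0 subr0.
Qed.

Lemma special_mapP w : basis_of fullv e ->
  tmap (@sl_val K n) id (special_map w) = gl_map w.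
Proof.
move=> be; have il := @id_linear K A.
have vl := sl_val_linear; have pl := sl_proj_linear.
have [p1 p2] := @pure_bilin K 'M[K]_n A.
have tl : linear (fun w' : witt Delta => pure (n%:R^-1%:M : 'M[K]_n) (divergence w')).
  exact: comp_linear (p2 _) (@divergence_linear _ _ Delta).
suff H (w' : witt Delta) : tmap (@sl_val K n) id (tmap sl_proj id (gl_map w')) =
    gl_map w' - pure (n%:R^-1%:M : 'M[K]_n) (divergence w').
  rewrite /special_map H; case: w => w /= /eqP ->.
  by case: (linP (p2 (n%:R^-1%:M))) => _ _ -> _; rewrite subr0.
move: w'; apply: (@tens_lin_eq K A Delta) => [||a d].
- apply: (comp_linear (tmap_linear vl il)).
  exact: comp_linear (tmap_linear pl il) gl_map_linear.
- by apply: sub_linear => //; apply: gl_map_linear.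
rewrite divergence_pure /gl_map (tlift_pure _ _ gl_map_bilin0).
have fe : free e by apply: basis_free be.
have dE : d = \sum_i coord e i d *: dd i.
  rewrite [LHS](coord_basis be) ?memvf //.
  by apply: eq_bigr => i _; rewrite (tnth_nth 0).
have trE (i j : 'I_n) : \tr (delta_mx i j : 'M[K]_n) = (i == j)%:R.
  rewrite /mxtrace (bigD1 i) //= big1 => [|k ki]; first by rewrite mxE eqxx addr0.
  by rewrite mxE (negPf ki).
have -> : pure (n%:R^-1%:M : 'M[K]_n) (d @ a) =
    \sum_i \sum_j pure ((\tr (delta_mx i j : 'M[K]_n) / n%:R)%:M)
                       (dd i @ (coord e j d *: a)).
  rewrite {1}dE (lin_sum _ _ (@der_lin _ _ Delta a)) (lin_sum _ _ (p2 _)).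
  apply: eq_bigr => i _; rewrite (bigD1 i) //= big1 => [|j ji].
    rewrite trE eqxx mul1r addr0; congr pure.
    case: (linP (@der_lin _ _ Delta a)) => _ -> _ _.
    by case: (linP (@der_der _ _ Delta (dd i)).1) => _ -> _ _.
  by rewrite trE eq_sym (negPf ji) mul0r raddf0 pure0l.
rewrite -sumrB (lin_sum _ _ (tmap_linear pl il)) (lin_sum _ _ (tmap_linear vl il)).
apply: eq_bigr => i _.
rewrite -sumrB (lin_sum _ _ (tmap_linear pl il)) (lin_sum _ _ (tmap_linear vl il)).
apply: eq_bigr => j _.
by rewrite !tmap_pure //= pureDl pureNl.
Qed.

End DivH.

(* Main.v *)
(* The projection [X |-> X - (tr X / n) 1] from [gl_n] to [sl_n] is a Lie algebra
   homomorphism, so composing it with [gl_map] gives a crossed homomorphism on the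
   whole of [W_n(A, Delta)], whose restriction to [S_n(A, Delta)] is [H].  Crossed
   means that [x |-> (x, H x)] is a Lie algebra homomorphism, and pulling the
   representation [alpha [+] theta] of the semidirect product back along it gives
   the functor. *)

Require Import Defs.
From mathcomp Require Import all_boot all_order all_algebra.
From mathcomp Require Import boolp reals complex.

Set Implicit Arguments.
Unset Strict Implicit.
Unset Printing Implicit Defensive.

Import GRing.Theory.
Local Open Scope ring_scope.

(** * The semidirect product acting on [V (x) A] *)

Section BoxPlus.
Variables (K : fieldType) (P : leibnizPair K) (g : lieAlgType K).
Variables (V : lmodType K) (theta : g -> V -> V).
Hypothesis theta_rep : is_rep theta.
Local Notation A := (lp_alg P).
Local Notation S := (lp_lie P).
Local Notation gA := (current g A).
Local Notation VA := (tens V A).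

(** The summands of [boxplus] are typed on the vector space [tens V A] rather than on its alias
    [tensA], so that [K]-linear reductions to pure tensors apply. *)
Definition coef_act (x : S) : VA -> VA := tmap id (lp_act x).

Definition cur_rep : gA -> VA -> VA :=
  tlift2 (fun h a v b => pure (theta h v) (a * b)).

Lemma coef_act_pure x v a : coef_act x (pure v a) = pure v (lp_act x a).
Proof. by rewrite /coef_act tmap_pure //; apply: (lp_act_der x).1. Qed.

Lemma coef_act_bilin : bilin coef_act.
Proof.
split=> [t|x]; last by apply: tmap_linear => //; apply: (lp_act_der x).1.
(* For fixed [t] the lift is a sum over [repr t], which does not involve [x]. *)
apply: sum_linear => p.
exact: comp_linear ((@pure_bilin K V A).2 _) (@lp_act_lin _ P p.2).
Qed.

Lemma cur_rep_quadrilin :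
  @quadrilin K g A V A VA (fun h a v b => pure (theta h v) (a * b)).
Proof.
have [[t1 t2] _] := theta_rep; have [m1 m2] := mulr_bilin A.
have pb := @pure_bilin K V A.
by split=> [h a|v b]; apply: bilin_comp pb.
Qed.

Lemma cur_rep_pure h a v b :
  cur_rep (pure h a) (pure v b) = pure (theta h v) (a * b).
Proof. by rewrite /cur_rep tlift2_pure //; apply: cur_rep_quadrilin. Qed.

Lemma cur_rep_bilin : bilin cur_rep.
Proof. by apply: tlift2_bilin; apply: cur_rep_quadrilin. Qed.

Lemma coef_act_lb x y t :
  coef_act (lb x y) t =
  coef_act x (coef_act y t) - coef_act y (coef_act x t).
Proof.
have [_ D2] := coef_act_bilin.
move: t; apply: (@tens_lin_eq K V A) => [||v a]; first exact: D2.
  by apply: sub_linear; apply: comp_linear; apply: D2.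
by rewrite !coef_act_pure lp_act_lb pureDr pureNr.
Qed.

(** On pure tensors this is the Leibniz rule for [lp_act x] on [a * b]. It handles the mixed terms
    in [boxplus_lb]. *)
Lemma coef_act_cur_rep x u t :
  coef_act x (cur_rep u t) = cur_rep (cur_act x u) t + cur_rep u (coef_act x t).
Proof.
have [_ D2] := coef_act_bilin; have [T1 T2] := cur_rep_bilin.
have C := @cur_act_linear _ P g x.
move: u; apply: (@tens_lin_eq K g A) => [||h a].
- exact: comp_linear (D2 x) (T1 t).
- by apply: add_linear; [exact: comp_linear (T1 t) C | exact: T1].
move: t; apply: (@tens_lin_eq K V A) => [||v b].
- exact: comp_linear (D2 x) (T2 _).
- by apply: add_linear; [exact: T2 | exact: comp_linear (T2 _) (D2 x)].
by rewrite cur_act_pure coef_act_pure !cur_rep_pure coef_act_pure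
  (lp_act_der x).2 pureDr.
Qed.

(** On pure tensors both composites have coefficient [a * a' * b], as [A] is commutative, which
    leaves the bracket relation of [theta]. *)
Lemma cur_rep_is_rep : is_rep cur_rep.
Proof.
split=> [|u u' t]; first exact: cur_rep_bilin.
have [T1 T2] := cur_rep_bilin; have [L1 L2] := @lb_bilin K gA.
move: u; apply: (@tens_lin_eq K g A) => [||h a].
- exact: comp_linear (T1 t) (L1 u').
- by apply: sub_linear; [exact: T1 | exact: comp_linear (T2 u') (T1 t)].
move: u'; apply: (@tens_lin_eq K g A) => [||h' a'].
- exact: comp_linear (T1 t) (L2 _).
- by apply: sub_linear; [exact: comp_linear (T2 _) (T1 t) | exact: T1].
move: t; apply: (@tens_lin_eq K V A) => [||v b].
- exact: T2.
- by apply: sub_linear; apply: comp_linear; apply: T2.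
have lbE (s s' : gA) : lb s s' = cur_lb s s' by [].
rewrite lbE cur_lb_pure !cur_rep_pure theta_rep.2 pureDl pureNl.
by rewrite mulrA [a' * (a * b)]mulrCA mulrA.
Qed.

Lemma boxplusE p t : boxplus theta p t = coef_act p.1 t + cur_rep p.2 t.
Proof. by []. Qed.

Lemma boxplus_bilin :
  bilin (boxplus theta : semidirect P g -> VA -> VA).
Proof.
have [D1 D2] := coef_act_bilin; have [T1 T2] := cur_rep_bilin.
split=> [t|p]; apply: add_linear.
- by move=> c p q; apply: D1.
- by move=> c p q; apply: T1.
- exact: D2.
- exact: T2.
Qed.

(** For [p = (x, u)] and [q = (y, v)], the mixed terms of the commutator add up to the action of
    [cur_act x v - cur_act y u], the mixed part of the semidirect bracket. *)
Lemma boxplus_lb (p q : semidirect P g) t :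
  boxplus theta (lb p q) t =
  boxplus theta p (boxplus theta q t) - boxplus theta q (boxplus theta p t).
Proof.
have [_ D2] := coef_act_bilin; have [T1 T2] := cur_rep_bilin.
have DD x : {morph coef_act x : a b / a + b} by case: (linP (D2 x)).
have TD u : {morph cur_rep u : a b / a + b} by case: (linP (T2 u)).
have Tl s : {morph cur_rep^~ s : a b / a + b} by case: (linP (T1 s)).
have TN s : {morph cur_rep^~ s : a / - a} by case: (linP (T1 s)).
case: p q => [x u] [y v]; rewrite !boxplusE /= coef_act_lb !Tl TN.
rewrite cur_rep_is_rep.2 !DD !TD !coef_act_cur_rep.
by apply/eqP; rewrite -subr_eq0; apply/eqP; zcancel.
Qed.

Lemma coef_actZ x (a : A) (t : VA) :
  coef_act x (tensA_scale a t) =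
  tensA_scale a (coef_act x t) + tensA_scale (lp_act x a) t.
Proof.
have [_ D2] := coef_act_bilin; have Zl b := @tensA_scale_linear K A V b.
move: t; apply: (@tens_lin_eq K V A) => [||v b].
- exact: comp_linear (D2 x) (Zl a).
- by apply: add_linear; [exact: comp_linear (Zl a) (D2 x) | exact: Zl].
rewrite coef_act_pure !tensA_scale_pure coef_act_pure.
by rewrite (lp_act_der x).2 addrC pureDr.
Qed.

Lemma cur_repZ u (a : A) (t : VA) :
  cur_rep u (tensA_scale a t) = tensA_scale a (cur_rep u t).
Proof.
have [T1 T2] := cur_rep_bilin; have Zl b := @tensA_scale_linear K A V b.
move: u; apply: (@tens_lin_eq K g A) => [||h c].
- exact: T1.
- exact: comp_linear (Zl a) (T1 t).
move: t; apply: (@tens_lin_eq K V A) => [||v b].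
- exact: comp_linear (T2 _) (Zl a).
- exact: comp_linear (Zl a) (T2 _).
by rewrite cur_rep_pure !tensA_scale_pure cur_rep_pure mulrCA.
Qed.

(** The derivation term comes from [coef_act] alone, because [cur_rep] is [A]-linear. *)
Lemma boxplusZ (p : semidirect P g) (a : A) (t : tensA A V) :
  boxplus theta p (a *: t) = a *: boxplus theta p t + lp_act p.1 a *: t.
Proof.
have ZE c (s : tensA A V) : c *: s = tensA_scale c s by [].
by rewrite scalerDr !ZE addrAC -coef_actZ -cur_repZ.
Qed.

End BoxPlus.

(** * Naturality of the actions in [V] *)

Section TmapEquivariance.
Variables (K : fieldType) (P : leibnizPair K) (g : lieAlgType K).
Variables (V W : lmodType K) (psi : V -> W).
Hypothesis psi_linear : linear psi.
Local Notation A := (lp_alg P).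

Let psi_tens : linear (tmap psi id : tens V A -> tens W A).
Proof. exact: tmap_linear. Qed.

Lemma tmap_tensA_scale (a : A) (t : tens V A) :
  tmap psi id (tensA_scale a t) = tensA_scale a (tmap psi id t).
Proof.
have Zl U := @tensA_scale_linear K A U a.
move: t; apply: (@tens_lin_eq K V A) => [||v b].
- exact: comp_linear psi_tens (Zl _).
- exact: comp_linear (Zl _) psi_tens.
by rewrite tensA_scale_pure !tmap_pure // tensA_scale_pure.
Qed.

Lemma tmap_coef_act (x : lp_lie P) (t : tens V A) :
  tmap psi id (coef_act x t) = coef_act x (tmap psi id t).
Proof.
have Dl U := (@coef_act_bilin K P U).2 x.
move: t; apply: (@tens_lin_eq K V A) => [||v b].
- exact: comp_linear psi_tens (Dl _).
- exact: comp_linear (Dl _) psi_tens.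
by rewrite coef_act_pure !tmap_pure // coef_act_pure.
Qed.

Lemma tmap_cur_rep (theta : g -> V -> V) (eta : g -> W -> W)
    (u : current g A) (t : tens V A) : is_rep theta -> is_rep eta ->
  (forall h v, psi (theta h v) = eta h (psi v)) ->
  tmap psi id (cur_rep theta u t) = cur_rep eta u (tmap psi id t).
Proof.
move=> theta_rep eta_rep psi_equi.
have [V1 V2] := cur_rep_bilin P theta_rep.
have [W1 W2] := cur_rep_bilin P eta_rep.
move: u; apply: (@tens_lin_eq K g A) => [||h a].
- exact: comp_linear psi_tens (V1 t).
- exact: W1.
move: t; apply: (@tens_lin_eq K V A) => [||v b].
- exact: comp_linear psi_tens (V2 _).
- exact: comp_linear (W2 _) psi_tens.
by rewrite cur_rep_pure // !tmap_pure // cur_rep_pure // psi_equi.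
Qed.

End TmapEquivariance.

(** * The functor of an arbitrary crossed homomorphism *)

Section CrossedFunctor.
Variables (K : fieldType) (P : leibnizPair K) (g : lieAlgType K).
Variable H : lp_lie P -> current g (lp_alg P).
Hypothesis H_crossed : crossed_hom H.
Local Notation A := (lp_alg P).

Lemma iota_crossed_linear :
  linear (iota_crossed H : lp_lie P -> semidirect P g).
Proof. by move=> c x y; congr pair; apply: H_crossed.1. Qed.

(** The second component of this equation is exactly the crossed homomorphism identity. *)
Lemma iota_crossed_lb x y :
  iota_crossed H (lb x y) = lb (iota_crossed H x) (iota_crossed H y).
Proof. by congr pair; apply: H_crossed.2. Qed.

Lemma crossed_is_arep (V : rep g) :
  is_arep (P := P) (M := tensA A (rep_mod V))
    (fun x => boxplus (rep_act (r := V)) (iota_crossed H x)).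
Proof.
have rP := rep_actP V; have [B1 B2] := boxplus_bilin P rP.
split=> [|x a m]; last exact: boxplusZ.
split=> [|x y v]; last by rewrite iota_crossed_lb; apply: boxplus_lb.
(* Admissibility lets [K] act through [A]; [scalRes_tensAE] identifies this with the scaling of
   [tens V A]. *)
split=> [t|x] c y z.
  by rewrite iota_crossed_linear B1 -[in LHS]scalRes_tensAE.
by rewrite [c *: y]scalRes_tensAE B2 -[in LHS]scalRes_tensAE.
Qed.

Lemma tmap_crossed_arep_hom (V W : rep g) (psi : mor (c := Rep g) V W) :
  is_arep_hom (M := ARepOb (crossed_is_arep V)) (N := ARepOb (crossed_is_arep W))
    (tmap (sval psi) id).
Proof.
case: psi => psi [psil psir] /=.
have il := @id_linear K A; have Fl := tmap_linear psil il.
have [FD _ _ _] := linP Fl.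
split=> [a t s|x t]; first by rewrite FD; congr (_ + _); apply: tmap_tensA_scale.
by rewrite /= FD tmap_coef_act // (tmap_cur_rep psil _ _ (rep_actP V) (rep_actP W)).
Qed.

Lemma crossed_is_functor :
  is_functor (C := Rep g) (D := ARep P)
    (F := fun V => ARepOb (crossed_is_arep V))
    (fun V W psi => exist _ (tmap (sval psi) id) (tmap_crossed_arep_hom psi)).
Proof.
have il := @id_linear K A.
(* Equality of morphisms reduces to the underlying functions, which by linearity are compared on
   pure tensors. *)
split=> [V|V W X [f [fl fr]] [h [hl hr]]]; apply: sval_inj; apply/funext => /=.
  by apply: (@tens_lin_eq K (rep_mod V) A) => [||v b] //;
    rewrite ?tmap_pure //; apply: tmap_linear.
apply: (@tens_lin_eq K (rep_mod V) A) => [||v b].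
- by apply: tmap_linear => //; apply: comp_linear.
- by apply: comp_linear; apply: tmap_linear.
by rewrite /= !tmap_pure //; apply: comp_linear.
Qed.
End CrossedFunctor.

(** * The crossed homomorphism on [W_n(A, Delta)] *)

Section WittCrossed.
Variables (K : numFieldType) (A : comAlgType K) (Delta : derSpace A).
Variables (n : nat) (e : n.-tuple Delta).
Hypothesis e_basis : basis_of (fullv : {vspace Delta}) e.
Local Notation "d @ a" := (der_fun d a) (at level 30, right associativity).
Local Notation dd i := (tnth e i).

Definition witt_pair : leibnizPair K :=
  @LeibnizPair K A (witt Delta) (@witt_act K A Delta)
    (@witt_act_der K A Delta) (@witt_act_lin K A Delta)
    (@witt_act_lb K A Delta).

(** Scalar matrices are central, and a commutator is traceless, hence fixed by the projection. *)
Lemma sl_proj_lb (X Y : 'M[K]_n) :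
  lb (sl_proj X) (sl_proj Y) = sl_proj (X *m Y - Y *m X).
Proof.
apply: val_inj => /=.
have -> : \tr (X *m Y - Y *m X) = 0 by rewrite raddfB /= mxtrace_mulC subrr.
rewrite mul0r raddf0 subr0.
set c := _ / _; set c' := _ / _.
rewrite !mulmxBl !mulmxBr !mul_scalar_mx !mul_mx_scalar.
have -> : c *: c'%:M = c' *: c%:M :> 'M[K]_n by rewrite !scale_scalar_mx mulrC.
apply/eqP; rewrite -subr_eq0; apply/eqP; zcancel.
Qed.

(** This is [\sum_j coord e j d *: E_ij], the [i]-th standard column times the coordinate row of
    [d]. Grouping the matrix units this way leaves a single sum in the image of [a (x) d]. *)
Definition coord_mx (i : 'I_n) (d : Delta) : 'M[K]_n :=
  \matrix_(k, j) ((k == i)%:R * coord e j d).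

(** The coordinate row of [d] meets the [k]-th standard column, which yields the scalar
    [coord e k d]. *)
Lemma coord_mxM i k d d' :
  coord_mx i d *m coord_mx k d' = coord e k d *: coord_mx i d'.
Proof.
apply/matrixP => r s; rewrite !mxE (bigD1 k) //= big1 => [|j jk].
  by rewrite !mxE eqxx mul1r addr0 -mulrA mulrCA.
by rewrite !mxE (negPf jk) mul0r mulr0.
Qed.

Lemma gl_map_pure a d :
  gl_map e (pure a d) = \sum_i pure (coord_mx i d) (dd i @ a).
Proof.
have [p1 p2] := @pure_bilin K 'M[K]_n A.
rewrite /gl_map (tlift_pure _ _ (gl_map_bilin0 e)); apply: eq_bigr => i _.
have -> : coord_mx i d = \sum_j coord e j d *: delta_mx i j.
  apply/matrixP => r s; rewrite mxE summxE (bigD1 s) //= big1 => [|j js].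
    by rewrite !mxE eqxx andbT addr0 mulrC.
  by rewrite !mxE [s == j]eq_sym (negPf js) andbF mulr0.
rewrite (lin_sum _ _ (p1 _)); apply: eq_bigr => j _.
case: (linP (p1 (dd i @ a))) => _ -> _ _.
case: (linP (@der_der _ _ Delta (dd i)).1) => _ -> _ _.
by case: (linP (p2 (delta_mx i j))) => _ -> _ _.
Qed.

(** Here the basis hypothesis enters: sums of coordinates produced by matrix products are turned
    back into [d]. *)
Lemma der_coord d a : d @ a = \sum_i coord e i d *: (dd i @ a).
Proof.
have dl := @der_lin _ _ Delta a.
rewrite {1}(coord_basis e_basis (memvf d)) (lin_sum _ _ dl).
by apply: eq_bigr => i _; case: (linP dl) => _ -> _ _; rewrite (tnth_nth 0).
Qed.

(** The pure tensors in a presentation of a divergence-free element need not be divergence free, so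
    the reduction to pure tensors is carried out on all of [witt Delta]. *)
Definition witt_map (w : witt Delta) : current (sl K n) A :=
  tmap (@sl_proj K n) id (gl_map e w).

Lemma witt_map_linear : linear witt_map.
Proof.
apply: comp_linear (gl_map_linear e).
exact: tmap_linear (@sl_proj_linear K n) (@id_linear K A).
Qed.

Lemma witt_map_pure a d :
  witt_map (pure a d) = \sum_i pure (sl_proj (coord_mx i d)) (dd i @ a).
Proof.
have pl := @sl_proj_linear K n; have il := @id_linear K A.
rewrite /witt_map gl_map_pure (lin_sum _ _ (tmap_linear pl il)).
by apply: eq_bigr => i _; rewrite tmap_pure.
Qed.

(** By [coord_mxM], each bracket of matrices is a combination of [coord_mx i d'] and [coord_mx j d].
    Its scalars move to the factor in [A], where [der_coord] sums them. *)
Lemma cur_lb_witt_map_pure a d b d' :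
  lb (witt_map (pure a d)) (witt_map (pure b d')) =
  \sum_i pure (sl_proj (coord_mx i d')) (dd i @ a * d @ b)
  - \sum_i pure (sl_proj (coord_mx i d)) (dd i @ b * d' @ a).
Proof.
have [l1 l2] := @lb_bilin K (current (sl K n) A).
have [p1 p2] := @pure_bilin K (sl K n) A.
have lbE (t t' : current (sl K n) A) : lb t t' = cur_lb t t' by [].
have [sD sZ _ sN] := linP (@sl_proj_linear K n).
have pZ X c u : pure (c *: X) u = pure X (c *: u) :> tens (sl K n) A.
  by case: (linP (p1 u)) => _ -> _ _; case: (linP (p2 X)) => _ -> _ _.
transitivity (\sum_i \sum_j
   (pure (sl_proj (coord_mx i d')) (dd i @ a * (coord e j d *: dd j @ b))
   - pure (sl_proj (coord_mx j d)) (dd j @ b * (coord e i d' *: dd i @ a)))).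
  rewrite !witt_map_pure (lin_sum _ _ (l1 _)); apply: eq_bigr => i _.
  rewrite (lin_sum _ _ (l2 _)); apply: eq_bigr => j _.
  rewrite lbE cur_lb_pure sl_proj_lb !coord_mxM sD sN !sZ pureDl pureNl !pZ.
  by rewrite -!scalerAr [X in _ - pure _ (_ *: X)]mulrC.
under eq_bigr => i _ do rewrite sumrB.
rewrite sumrB; congr (_ - _).
  apply: eq_bigr => i _; rewrite -(lin_sum _ _ (p2 _)) -mulr_sumr.
  by rewrite -der_coord.
(* In the second half the coordinates of [d'] are indexed by the outer variable. *)
rewrite exchange_big; apply: eq_bigr => i _.
by rewrite -(lin_sum _ _ (p2 _)) -mulr_sumr -der_coord.
Qed.

(** On pure tensors, Leibniz splits [dd i @ (a * d @ b)] into [dd i @ a * d @ b], supplied by the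
    bracket of the images, and [a * dd i @ d @ b], supplied by the action since [dd i] and [d]
    commute. *)
Lemma witt_map_crossed : crossed_hom (P := witt_pair) witt_map.
Proof.
split=> [|w w']; first exact: witt_map_linear.
have [w1 w2] := @witt_lb_bilin K A Delta; have Hl := witt_map_linear.
have [c1 c2] := @cur_act_bilin K witt_pair (sl K n).
have [l1 l2] := @lb_bilin K (current (sl K n) A).
move: w; apply: (@tens_lin_eq K A Delta) => [||a d].
- exact: comp_linear Hl (w1 w').
- apply: add_linear; last exact: comp_linear (l1 _) Hl.
  by apply: sub_linear; [exact: c1 | exact: comp_linear (c2 _) Hl].
move: w'; apply: (@tens_lin_eq K A Delta) => [||b d'].
- exact: comp_linear Hl (w2 _).
- apply: add_linear; last exact: comp_linear (l2 _) Hl.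
  by apply: sub_linear; [exact: comp_linear (c2 _) Hl | exact: c1].
have [HD _ _ HN] := linP Hl.
have lbE (t t' : witt Delta) : lb t t' = witt_lb t t' by [].
rewrite lbE witt_lb_pure HD HN cur_lb_witt_map_pure !witt_map_pure.
(* Terms are regrouped by the matrix they carry, [coord_mx i d'] or [coord_mx i d]. *)
rewrite !(lin_sum _ _ (c2 _)) addrACA -opprD -!big_split /=.
have leib := (@der_der _ _ Delta _).2.
by congr (_ - _); apply: eq_bigr => i _;
  rewrite cur_act_pure -pureDr /= witt_act_pure leib der_comm addrC.
Qed.

End WittCrossed.

(** Bracket and action on [special Delta] are computed in [witt Delta], so both conditions are
    instances of those for [witt_map]. *)
Lemma special_map_crossed (K : numFieldType) (A : comAlgType K)
    (Delta : derSpace A) (n : nat) (e : n.-tuple Delta) :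
  basis_of (fullv : {vspace Delta}) e ->
  crossed_hom (P := special_pair Delta) (special_map e).
Proof.
move=> /witt_map_crossed[Hl Hlb]; split=> [c x y|x y]; first exact: Hl.
exact: Hlb (special_val x) (special_val y).
Qed.

(** Objects and morphisms are sent to explicit formulas; only the proofs [adm] and [equi] that these
    are admissible and equivariant are existential. *)
Theorem corollary4p17 (R : realType) (A : comAlgType R[i]) (Delta : derSpace A)
    (n : nat) (e : n.-tuple Delta)
    (Delta_neq0 : fullv != 0%VS :> {vspace Delta})
    (e_basis : basis_of (fullv : {vspace Delta}) e) :
  let S : leibnizPair R[i] := special_pair Delta in
  let slC : lieAlgType R[i] := sl R[i] n in
  let H : lp_lie S -> current slC (lp_alg S) := special_map e in
  crossed_hom H /\
  exists (adm : forall V : rep slC,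
            is_arep (P := S) (M := tensA A (rep_mod V))
              (fun x => boxplus (rep_act (r := V)) (iota_crossed H x)))
         (equi : forall (V W : rep slC) (psi : mor (c := Rep slC) V W),
            is_arep_hom (M := ARepOb (adm V)) (N := ARepOb (adm W))
              (tmap (sval psi) id)),
    is_functor (C := Rep slC) (D := ARep S)
      (F := fun V => ARepOb (adm V))
      (fun V W psi => exist _ (tmap (sval psi) id) (equi V W psi)).
Proof.
move=> S slC H; have H_crossed : crossed_hom H := special_map_crossed e_basis.
split=> //; exists (crossed_is_arep H_crossed).
by exists (tmap_crossed_arep_hom H_crossed); apply: crossed_is_functor.
Qed.
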